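(* Let $G$ be a finite undirected graph (possibly with loops and multiple edges) with nonempty vertex set $V$ and edge set $E$, and let $b\in\mathbb{R}^V$ be nonzero with all entries nonnegative. Let $U$ be a subset of the set of vertices of the polytope $\mathcal{P}(G,b)$. Then $U$ is the set of vertices of a face of $\mathcal{P}(G,b)$ if and only if the elements of $U$ are the only vertices of $\mathcal{P}(G,b)$ whose graphs are contained in the graph $\mathrm{gr}(U)$ of $U$.
   Context: $\delta_G(v)$ denotes the set of edges of $G$ incident with $v$; a loop at $v$ appears once in $\delta_G(v)$. $\mathcal{P}(G,b)=\{x\in\mathbb{R}^E \mid x_e\ge 0 \text{ for each } e\in E,\ \sum_{e\in\delta_G(v)}x_e=b_v \text{ for each } v\in V\}$ (empty when $E=\emptyset$, since $b\ne0$). The faces of a polytope include $\emptyset$ and the polytope itself. For $X\subset\mathcal{P}(G,b)$, the graph $\mathrm{gr}(X)$ of $X$ is the spanning subgraph of $G$ (vertex set $V$) with edge set $\{e\in E\mid \text{there exists } x\in X\text{ with }x_e>0\}$, and the graph of an element $x$ is $\mathrm{gr}(x)=\mathrm{gr}(\{x\})$. Containment of spanning subgraphs of $G$ means containment of their edge sets. *)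

(* Defs.v *)
From mathcomp Require Import all_boot all_order all_algebra.
From mathcomp Require Import boolp classical_sets reals.

Set Implicit Arguments.
Unset Strict Implicit.
Unset Printing Implicit Defensive.

Import Order.TTheory GRing.Theory Num.Theory.

Local Open Scope classical_set_scope.
Local Open Scope ring_scope.

(* [ends e] is the set of endpoints of [e], so loops are the edges with a
   single endpoint and parallel edges are edges with the same [ends]. *)
Record multigraph (V E : finType) := Multigraph {
  ends : E -> {set V};
  ends_card : forall e, (0 < #|ends e| <= 2)%N
}.

(* As a set, it contains a loop at [v] only once. *)
Definition incident_edges (V E : finType) (G : multigraph V E) (v : V)
    : {set E} :=
  finset (fun e => v \in ends G e).

Definition graph_polytope (R : realType) (V E : finType)
    (G : multigraph V E) (b : {ffun V -> R}) : set {ffun E -> R} :=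
  [set x | (forall e, 0 <= x e) /\
           (forall v, \sum_(e in incident_edges G v) x e = b v)].

Definition dotf (R : realType) (E : finType) (c x : {ffun E -> R}) : R :=
  \sum_e c e * x e.

(* [F] is cut out of [P] by a valid linear inequality; the functional [c] may
   be zero, so that [P] and the empty set are faces of [P]. *)
Definition is_face (R : realType) (E : finType) (P F : set {ffun E -> R})
    : Prop :=
  exists (c : {ffun E -> R}) (d : R),
    (forall x, P x -> dotf c x <= d) /\ F = P `&` [set x | dotf c x = d].

(* Vertices are the zero-dimensional faces. *)
Definition vertices (R : realType) (E : finType) (P : set {ffun E -> R})
    : set {ffun E -> R} :=
  [set x | is_face P [set x]].

(* A spanning subgraph is determined by, and encoded as, its edge set;
   containment of spanning subgraphs is then inclusion of sets. *)
Definition spanning_subgraph (V E : finType) (G : multigraph V E) : Type :=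
  set E.

Definition gr (R : realType) (V E : finType) (G : multigraph V E)
    (X : set {ffun E -> R}) : spanning_subgraph G :=
  [set e | exists2 x, X x & 0 < x e].

(* Main.v *)
(** Everything rests on one construction: if [x] and [y] lie in the polytope and
    the support of [y] is contained in that of [x], then the segment from [y] to
    [x] can be prolonged beyond [x] inside the polytope.  A linear functional
    that is maximal at [x] is then maximal at [y] too.  Hence a face containing
    [x] contains every point supported on [gr x], and the points supported on a
    given edge set form a face; [x] is a vertex if and only if it is the only
    point supported on [gr x].  Averaging finitely many elements of [U] gives a
    single point of the face whose graph contains [gr U]. *)

Require Import Defs.
From mathcomp Require Import all_boot all_order all_algebra.
From mathcomp Require Import boolp classical_sets reals.
From mathcomp Require Import ring lra.

Set Implicit Arguments.
Unset Strict Implicit.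
Unset Printing Implicit Defensive.

Import Order.TTheory GRing.Theory Num.Theory.

Local Open Scope classical_set_scope.
Local Open Scope ring_scope.

Lemma gr1E (R : realType) (V E : finType) (G : multigraph V E)
    (x : {ffun E -> R}) : gr G [set x] = [set e | 0 < x e].
Proof.
by apply/seteqP; split=> e /= => [[y -> //]|xe]; exists x.
Qed.

Lemma le_scale_support (R : realType) (E : finType) (x y : {ffun E -> R}) :
  (forall e, 0 <= x e) -> (forall e, 0 <= y e) ->
  (forall e, 0 < y e -> 0 < x e) ->
  exists2 t : R, 0 < t & forall e, t * y e <= x e.
Proof.
(* Each ratio [y e / x e] is at most [s], so [s^-1] works for all edges at once; the added 1 keeps
   [s] positive even if [y] vanishes. *)
move=> x0 y0 yx; pose s := \sum_e y e / x e + 1.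
have q0 e : 0 <= y e / x e by rewrite divr_ge0.
have s0 : 0 < s by rewrite ltr_wpDl// sumr_ge0.
exists s^-1 => [|e]; first by rewrite invr_gt0.
rewrite ler_pdivrMl//; have [ye|ye] := ltP 0 (y e); last first.
  by rewrite (le_trans ye)// mulr_ge0// ltW.
rewrite -ler_pdivrMr ?yx// /s (bigD1 e)//= -addrA lerDl.
by rewrite addr_ge0// sumr_ge0.
Qed.

Lemma dotf_beyond (R : realType) (E : finType) (c x y : {ffun E -> R}) (t : R) :
  dotf c [ffun e => x e + t * (x e - y e)] =
  dotf c x + t * (dotf c x - dotf c y).
Proof.
rewrite /dotf -sumrB mulr_sumr -big_split/=.
by apply: eq_bigr => e _; rewrite ffunE; ring.
Qed.

(** The vertex equations survive for every [t], since [x - y] sums to 0 around each vertex; only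
    nonnegativity restricts [t], and [t * y e <= x e] secures it. Where [x] vanishes, [z] equals
    [- t * y], so no new edge appears. *)
Lemma graph_polytope_beyond (R : realType) (V E : finType)
    (G : multigraph V E) (b : {ffun V -> R}) (x y : {ffun E -> R}) :
  graph_polytope G b x -> graph_polytope G b y ->
  gr G [set y] `<=` gr G [set x] ->
  exists2 t : R, 0 < t &
    let z := [ffun e => x e + t * (x e - y e)] in
    graph_polytope G b z /\ gr G [set z] `<=` gr G [set x].
Proof.
move=> [x0 xb] [y0 yb]; rewrite !gr1E => yx.
have [t t0 tyx] := le_scale_support x0 y0 yx; exists t => //=.
split; first split.
- move=> e; rewrite ffunE; have := tyx e; have := x0 e => ? ?.
  by have : 0 <= t * x e by [rewrite mulr_ge0// ltW]; nra.
- move=> v; under eq_bigr do rewrite ffunE.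
  by rewrite big_split/= -mulr_sumr sumrB xb yb subrr mulr0 addr0.
- rewrite gr1E => e /=; rewrite ffunE [in X in _ -> X]lt0r x0 andbT.
  apply: contraTneq => ->; rewrite add0r sub0r -leNgt pmulr_rle0//.
  by rewrite oppr_le0.
Qed.

(** If [y] fell below the level [d] attained at [x], the affine function [dotf c] would exceed [d]
    beyond [x]. *)
Lemma dotf_beyond_eq (R : realType) (E : finType) (c x y : {ffun E -> R})
    (t d : R) :
  0 < t -> dotf c x = d -> dotf c y <= d ->
  dotf c [ffun e => x e + t * (x e - y e)] <= d -> dotf c y = d.
Proof.
move=> t0 xd yd; rewrite dotf_beyond xd gerDl pmulr_rle0// subr_le0 => dy.
by apply/eqP; rewrite eq_le yd.
Qed.

Lemma sub_is_face (R : realType) (E : finType) (P F : set {ffun E -> R}) :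
  is_face P F -> F `<=` P.
Proof. by move=> [c [d [_ ->]]] x []. Qed.

Lemma sub_vertices (R : realType) (E : finType) (P : set {ffun E -> R}) :
  vertices P `<=` P.
Proof. by move=> x /sub_is_face; apply. Qed.

Lemma vertices_sub (R : realType) (E : finType) (P F : set {ffun E -> R})
    (x : {ffun E -> R}) : F `<=` P -> F x -> vertices P x -> vertices F x.
Proof.
move=> FP Fx [c [d [cd xE]]]; exists c, d; split=> [y /FP/cd //|].
have [_ cx] : (P `&` [set y | dotf c y = d]) x by rewrite -xE.
apply/seteqP; split=> [_ -> //|y [Fy cy]].
by rewrite xE; split=> //; exact: FP.
Qed.

Lemma is_face_support (R : realType) (V E : finType) (G : multigraph V E)
    (b : {ffun V -> R}) (S : set E) :
  is_face (graph_polytope G b)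
    (graph_polytope G b `&` [set x | gr G [set x] `<=` S]).
Proof.
(* [dotf c x] is minus the total weight of [x] outside [S]; on the polytope its bound 0 is attained
   exactly when that weight vanishes. *)
pose c : {ffun E -> R} := [ffun e => - (e \notin S)%:R].
have c_le0 x : graph_polytope G b x -> forall e, c e * x e <= 0.
  by move=> [x0 _] e; rewrite ffunE mulNr oppr_le0 mulr_ge0.
exists c, 0; split=> [x /c_le0 cx|]; first exact: sumr_le0.
apply/seteqP; split=> x [Px /=] xS; split=> //=; move: xS; rewrite gr1E.
- move=> xS; apply: big1 => e _; rewrite ffunE.
  have [/mem_set -> |] := pselect (S e); first by rewrite oppr0 mul0r.
  case: Px => x0 _; have [/xS //|xe _] := ltP 0 (x e).
  by rewrite (@le_anti _ _ (x e) 0) ?mulr0// xe x0.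
- move=> /eqP cx0 e /= xe; apply: contrapT => Se; move: cx0; apply/negP.
  rewrite lt_eqF// /dotf (bigD1 e)//= ltr_wnDr//.
    by apply: sumr_le0 => i _; exact: c_le0.
  by rewrite ffunE memNset// mulN1r oppr_lt0.
Qed.

Lemma is_face_gr (R : realType) (V E : finType) (G : multigraph V E)
    (b : {ffun V -> R}) (F : set {ffun E -> R}) (x y : {ffun E -> R}) :
  is_face (graph_polytope G b) F -> F x -> graph_polytope G b y ->
  gr G [set y] `<=` gr G [set x] -> F y.
Proof.
move=> [c [d [cd ->]]] [Px cx] Py yx; split=> //.
have [t t0 [/cd zd _]] := graph_polytope_beyond Px Py yx.
exact: dotf_beyond_eq t0 cx (cd _ Py) zd.
Qed.

Lemma vertices_support (R : realType) (V E : finType) (G : multigraph V E)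
    (b : {ffun V -> R}) (S : set E) :
  vertices (graph_polytope G b `&` [set x | gr G [set x] `<=` S]) =
  vertices (graph_polytope G b) `&` [set x | gr G [set x] `<=` S].
Proof.
apply/seteqP; split=> x; last first.
  move=> [xv xS]; apply: vertices_sub (xv); first exact: subIsetl.
  by split=> //; exact: sub_vertices.
move=> xv; have [Px xS] := sub_vertices xv; split=> //.
case: xv => c [d [cd xE]].
have [_ cx] : (graph_polytope G b `&` [set x | gr G [set x] `<=` S] `&`
    [set y | dotf c y = d]) x by rewrite -xE.
(* The functional [c] is valid only on the smaller face. A functional for the whole polytope comes
   from [is_face_support], once [x] is the only point supported on its own graph. *)
rewrite /vertices/=; suff -> : [set x] = graph_polytope G b `&`
    [set y | gr G [set y] `<=` gr G [set x]] by exact: is_face_support.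
apply/seteqP; split=> [_ ->|y [Py yx]]; first by split.
have [t t0 [Pz zx]] := graph_polytope_beyond Px Py yx.
rewrite xE; split; first by split=> //; exact: subset_trans xS.
apply: (dotf_beyond_eq t0 cx); apply: cd; split=> //=; exact: subset_trans xS.
Qed.

(** This is where [b <> 0] enters: a point without positive entries is 0 and would force [b] to be
    0. *)
Lemma gr_neq0 (R : realType) (V E : finType) (G : multigraph V E)
    (b : {ffun V -> R}) (x : {ffun E -> R}) :
  b <> 0 -> graph_polytope G b x -> gr G [set x] !=set0.
Proof.
move=> b0 [x0 xb]; rewrite gr1E; apply: contrapT => /nonemptyPn xE.
apply: b0; apply/ffunP => v; rewrite -xb ffunE.
apply: big1 => e _; apply/le_anti; rewrite x0 andbT leNgt; apply/negP => xe.
by have : [set e | 0 < x e] e by []; rewrite xE.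
Qed.

Lemma is_face_center (R : realType) (V E : finType) (G : multigraph V E)
    (b : {ffun V -> R}) (F U : set {ffun E -> R}) :
  is_face (graph_polytope G b) F -> U `<=` F -> gr G U !=set0 ->
  exists2 u, F u & gr G U `<=` gr G [set u].
Proof.
move=> Fface UF [e0 [u0 Uu0 _]].
have n0 : 0 < #|E|%:R :> R by rewrite ltr0n; apply/card_gt0P; exists e0.
(* The average runs over [E], so finiteness of [U] need not be known: each edge of [gr U] picks a
   member of [U] positive on it, and every other edge picks [u0]. *)
have /choice[w wP] e : exists u, U u /\ (gr G U e -> 0 < u e).
  have [[u Uu ue]|/= nUe] := pselect (gr G U e); first by exists u.
  by exists u0.
have wF e : F (w e) by apply: UF; have [] := wP e.
have w0 e f : 0 <= w e f by have [] := sub_is_face Fface (wF e).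
exists [ffun f => #|E|%:R^-1 * \sum_e w e f]; last first.
  move=> e Ue; rewrite gr1E /= ffunE mulr_gt0 ?invr_gt0//.
  by rewrite (bigD1 e)//= ltr_wpDr ?sumr_ge0//; have [_] := wP e; apply.
have avg (a : R) : #|E|%:R^-1 * (\sum_(e : E) a) = a.
  by rewrite sumr_const -[a *+ _]mulr_natl mulrA mulVf ?mul1r// gt_eqF.
have [c [d [cd FE]]] := Fface; rewrite FE; split; first split.
- by move=> f; rewrite ffunE mulr_ge0 ?invr_ge0 ?sumr_ge0// ltW.
- move=> v; under eq_bigr do rewrite ffunE.
  rewrite -mulr_sumr exchange_big/= -[RHS]avg; congr (_ * _).
  by apply: eq_bigr => e _; have [_] := sub_is_face Fface (wF e).
- rewrite /= /dotf; under eq_bigr do rewrite ffunE mulrCA mulr_sumr.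
  rewrite -mulr_sumr exchange_big/= -[RHS]avg; congr (_ * _).
  by apply: eq_bigr => e _; have := wF e; rewrite FE => -[_].
Qed.

Theorem theorem30 (R : realType) (V E : finType) (G : multigraph V E)
    (b : {ffun V -> R}) (U : set {ffun E -> R})
    (V_neq0 : (0 < #|V|)%N)
    (b_ge0 : forall v, 0 <= b v)
    (b_neq0 : b <> 0)
    (U_sub : U `<=` vertices (graph_polytope G b)) :
  (exists2 F : set {ffun E -> R},
     is_face (graph_polytope G b) F & U = vertices F) <->
  U = [set x | vertices (graph_polytope G b) x /\
               gr G [set x] `<=` gr G U].
Proof.
split=> [[F Fface UE]|UE].
- apply/seteqP; split=> x.
    by move=> Ux; split; [exact: U_sub | move=> e [_ -> xe]; exists x].
  move=> [xv xU]; have Px := sub_vertices xv.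
  (* An edge of [x] lies in [gr U], so [U] is nonempty and can be averaged. *)
  have [e /xU Ue] := gr_neq0 b_neq0 Px.
  have UF : U `<=` F by rewrite UE; exact: sub_vertices.
  have [|u Fu Uu] := is_face_center Fface UF; first by exists e.
  rewrite UE; apply: vertices_sub (xv); first exact: sub_is_face.
  exact: is_face_gr Fface Fu Px (subset_trans xU Uu).
- exists (graph_polytope G b `&` [set x | gr G [set x] `<=` gr G U]).
    exact: is_face_support.
  (* Only the left-hand [U] is unfolded; the one inside [gr U] is the fixed support. *)
  by rewrite {1}UE vertices_support.
Qed.
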